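(* Let $R$ be a ring with identity, let $M$ be a (right) $R$-module, and let $n \ge 0$ be an integer. Suppose $$P_n \xrightarrow{\partial_n} P_{n-1} \xrightarrow{\partial_{n-1}} \cdots \xrightarrow{\partial_2} P_1 \xrightarrow{\partial_1} P_0 \xrightarrow{\epsilon} M \to 0$$ and $$Q_n \xrightarrow{\partial_n'} Q_{n-1} \xrightarrow{\partial_{n-1}'} \cdots \xrightarrow{\partial_2'} Q_1 \xrightarrow{\partial_1'} Q_0 \xrightarrow{\epsilon'} M \to 0$$ are exact sequences of $R$-modules in which all the $P_i$ and $Q_i$ are projective. Define projective modules $T_i, S_i$ inductively by $T_0 \cong P_0$, $S_0 \cong Q_0$, and for $i = 1,\dots,n$, $$T_i \cong S_{i-1} \oplus P_i, \qquad S_i \cong T_{i-1} \oplus Q_i.$$ Then the chain complexes $$P_n \oplus S_n \xrightarrow{\partial_n \oplus 0} P_{n-1} \xrightarrow{\partial_{n-1}} \cdots \xrightarrow{\partial_2} P_1 \xrightarrow{\partial_1} P_0$$ and $$Q_n \oplus T_n \xrightarrow{\partial_n' \oplus 0} Q_{n-1} \xrightarrow{\partial_{n-1}'} \cdots \xrightarrow{\partial_2'} Q_1 \xrightarrow{\partial_1'} Q_0$$ are chain homotopy equivalent.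
   Context: All modules are right $R$-modules. Given module maps $f: A \to C$ and $g: B \to C$ with the same target, $f \oplus g: A \oplus B \to C$ denotes the map $(a,b) \mapsto f(a) + g(b)$. No injectivity of $\partial_n$ or $\partial_n'$ is assumed (exactness is required at $P_{n-1},\dots,P_0$, $M$ and at $Q_{n-1},\dots,Q_0$, $M$). The module $M$ is not part of the two chain complexes; $P_i$ and $Q_i$ (and the stabilized modules for $i=n$) sit in degree $i$. *)

(* Defs.v *)
From HB Require Import structures.
From mathcomp Require Import all_boot all_order all_algebra.

Set Implicit Arguments.
Unset Strict Implicit.
Unset Printing Implicit Defensive.

Import GRing.Theory.
Local Open Scope ring_scope.

(* Everything is developed for left modules over a ring K; a right R-module  *)
(* is a left module over the converse ring, i.e. an object of lmodType R^c.  *)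

Section Modules.
Variable K : pzRingType.

Definition surjective (A B : lmodType K) (f : {linear A -> B}) : Prop :=
  forall y, exists x, f x = y.

Definition exact_at (A B C : lmodType K)
    (f : {linear A -> B}) (g : {linear B -> C}) : Prop :=
  forall y, g y = 0 <-> exists x, f x = y.

Definition projective (P : lmodType K) : Prop :=
  forall (X Y : lmodType K) (g : {linear X -> Y}) (f : {linear P -> Y}),
    surjective g -> exists h : {linear P -> X}, forall p, g (h p) = f p.

Definition mod_iso (A B : lmodType K) : Prop :=
  exists f : {linear A -> B}, bijective f.

Definition zero_mod : lmodType K := 'rV[K]_0.

Section MapOplus.
Variables (A B C : lmodType K) (f : {linear A -> C}) (g : {linear B -> C}).

Definition map_oplus (x : A * B) : C := f x.1 + g x.2.

Lemma map_oplus_is_linear : linear map_oplus.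
Proof.
by move=> a x y; rewrite /map_oplus /= !linearP scalerDr addrACA.
Qed.

HB.instance Definition _ :=
  GRing.isLinear.Build K (A * B)%type C *:%R map_oplus map_oplus_is_linear.

End MapOplus.

End Modules.

Section ChainComplexes.
Variable K : pzRingType.

(* Complexes in nonnegative degrees; chain_diff i goes from degree i.+1 to   *)
(* degree i.                                                                 *)
Record chain_complex := ChainComplex {
  chain_obj :> nat -> lmodType K;
  chain_diff : forall i, {linear chain_obj i.+1 -> chain_obj i};
  chain_diffK : forall i x, chain_diff i (chain_diff i.+1 x) = 0
}.

Record chain_map (C D : chain_complex) := ChainMap {
  chain_fun :> forall i, {linear C i -> D i};
  chain_funE : forall i x,
    chain_fun i (chain_diff C i x) = chain_diff D i (chain_fun i.+1 x)
}.

Definition chain_id (C : chain_complex) : chain_map C C :=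
  @ChainMap C C (fun i => idfun) (fun i x => erefl).

Lemma chain_comp_subproof (C D E : chain_complex)
    (g : chain_map D E) (f : chain_map C D) i x :
  (g i \o f i) (chain_diff C i x) = chain_diff E i ((g i.+1 \o f i.+1) x).
Proof. by rewrite /= !chain_funE. Qed.

Definition chain_comp (C D E : chain_complex)
    (g : chain_map D E) (f : chain_map C D) : chain_map C E :=
  @ChainMap C E (fun i => (g i \o f i)) (chain_comp_subproof g f).

Definition chain_homotopic (C D : chain_complex) (f g : chain_map C D) : Prop :=
  exists h : forall i, {linear C i -> D i.+1},
    (forall x, f 0%N x - g 0%N x = chain_diff D 0%N (h 0%N x)) /\
    (forall i x, f i.+1 x - g i.+1 x =
       chain_diff D i.+1 (h i.+1 x) + h i (chain_diff C i x)).

Definition chain_homotopy_equivalent (C D : chain_complex) : Prop :=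
  exists (f : chain_map C D) (g : chain_map D C),
    chain_homotopic (chain_comp g f) (chain_id C) /\
    chain_homotopic (chain_comp f g) (chain_id D).

End ChainComplexes.

Section Stabilization.
Variable K : pzRingType.

(* A sequence P_n -> ... -> P_0 -> M -> 0 is given by families indexed by    *)
(* nat, of which only the P i with i <= n and the d i with i < n matter;     *)
(* d i : P i.+1 -> P i is the differential usually written \partial_(i+1).   *)
Definition exact_seq (n : nat) (P : nat -> lmodType K)
    (d : forall i, {linear P i.+1 -> P i})
    (M : lmodType K) (eps : {linear P 0%N -> M}) : Prop :=
  [/\ surjective eps,
      (0 < n)%N -> exact_at (d 0%N) eps &
      forall i, (i.+1 < n)%N -> exact_at (d i.+1) (d i)].

(* The modules of P_n (+) S -> P_(n-1) -> ... -> P_0, zero above degree n.   *)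
(* The recursion, which removes P_0 and shifts degrees, makes the source and *)
(* target of each differential below reduce to the intended modules.         *)
Fixpoint stab_obj (P : nat -> lmodType K) (S : lmodType K) (n i : nat)
    : lmodType K :=
  match n, i with
  | 0, 0 => (P 0%N * S)%type
  | 0, _.+1 => zero_mod K
  | _.+1, 0 => P 0%N
  | m.+1, j.+1 => stab_obj (fun k => P k.+1) S m j
  end.

Lemma stab_obj_lt P S n i : (i < n)%N -> stab_obj P S n i = P i.
Proof. by elim: n P i => [|n IHn] P [|i] //= lt_in; rewrite IHn. Qed.

Lemma stab_obj_top P S n : stab_obj P S n n = (P n * S)%type :> lmodType K.
Proof. by elim: n P => [|n IHn] P //=; rewrite IHn. Qed.

Lemma stab_obj_gt P S n i : (n < i)%N -> stab_obj P S n i = zero_mod K.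
Proof. by elim: n P i => [|n IHn] P [|i] //= lt_ni; rewrite IHn. Qed.

Definition stab_diff0 (P : nat -> lmodType K) (S : lmodType K)
    (d : {linear P 1%N -> P 0%N}) (m : nat)
    : {linear stab_obj (fun k => P k.+1) S m 0%N -> P 0%N} :=
  match m with
  | 0 => map_oplus d (\0 : {linear S -> P 0%N})
  | _.+1 => d
  end.

Fixpoint stab_diff (P : nat -> lmodType K)
    (d : forall i, {linear P i.+1 -> P i}) (S : lmodType K) (n : nat)
    : forall i, {linear stab_obj P S n i.+1 -> stab_obj P S n i} :=
  match n with
  | 0 => fun i => \0
  | m.+1 => fun i =>
      match i with
      | 0 => stab_diff0 S (d 0%N) m
      | j.+1 => stab_diff (fun k => d k.+1) S m j
      end
  end.

Lemma stab_diffK n (P : nat -> lmodType K)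
    (d : forall i, {linear P i.+1 -> P i})
    (M : lmodType K) (eps : {linear P 0%N -> M}) (S : lmodType K) :
  exact_seq n d eps ->
  forall i x, stab_diff d S n i (stab_diff d S n i.+1 x) = 0.
Proof.
case=> _ _ ex_d.
have {ex_d} dd i : (i.+1 < n)%N -> forall x, d i (d i.+1 x) = 0.
  by move=> lt_in x; apply/(ex_d i lt_in); exists x.
elim: n P d dd {M eps} => [|n IHn] P d dd i x //=.
case: i x => [|i] x; last by apply: (IHn) => j; apply: (dd j.+1).
case: n {IHn} dd x => [|[|n]] dd x /=.
- exact: linear0.
- by rewrite /map_oplus /= addr0 (dd 0).
- exact: (dd 0).
Qed.

Definition stab_complex n (P : nat -> lmodType K)
    (d : forall i, {linear P i.+1 -> P i})
    (M : lmodType K) (eps : {linear P 0%N -> M})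
    (ex_P : exact_seq n d eps) (S : lmodType K) : chain_complex K :=
  ChainComplex (stab_diffK (S := S) ex_P).

End Stabilization.

(* Main.v *)
Require Import Defs.
From HB Require Import structures.
From mathcomp Require Import all_boot all_order all_algebra.

Set Implicit Arguments.
Unset Strict Implicit.
Unset Printing Implicit Defensive.

Import GRing.Theory.
Local Open Scope ring_scope.

(** The two given sequences are compared by peeling off their lowest modules
one at a time. By Schanuel's argument the projectivity of P_0 and Q_0 gives
mutually inverse isomorphisms between P_0 (+) Q_0 and Q_0 (+) P_0 which are
compatible with the maps eps (+) 0 and eps' (+) 0 to M (lemma [schanuel]).
Adding the contractible complex Q_0 = Q_0 in degrees 0 and 1 does not change the
homotopy type of the complex of P ([expand_equiv]); symmetrically P_0 = P_0 is
added to the complex of Q. The two enlarged complexes now have isomorphic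
modules in degree 0, and exactness at P_0 and Q_0 says that
P_1 (+) Q_0 -> P_0 (+) Q_0 and Q_1 (+) P_0 -> Q_0 (+) P_0 have corresponding
images. So what remains is the same problem, of length one less, for the
sequences that start with P_1 (+) Q_0 and Q_1 (+) P_0. These two modules are
T_1 and S_1 up to isomorphism: the recursion for T and S keeps track of the
lowest modules during the peeling. When only the top degree is left, its
modules before stabilization are T_n and S_n up to isomorphism, and the
stabilized ones, T_n (+) S_n and S_n (+) T_n, are matched by Schanuel's
isomorphism ([stab_equiv]).

For the induction to close up, three things are built into [stab_equiv]. The
augmentation module is placed at index 0 of the sequence, so that peeling is a
shift of indices. The two augmentation modules are only required to be
isomorphic, and the augmentations to have corresponding images; surjectivity
is lost after the first step. The homotopy equivalences are relative to
index 0: they extend the given isomorphism of augmentation modules and their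
homotopies vanish there ([rel_equiv]). This is what allows an equivalence of
the peeled complexes to be extended by the removed module ([rel_equiv_cons]),
and forgetting index 0 at the end yields an ordinary homotopy equivalence. *)

(** * Linear maps and projective modules *)

Section LinearMaps.
Variable K : pzRingType.

Section Pairing.
Variables (A B C : lmodType K) (f : {linear A -> B}) (g : {linear A -> C}).

Definition pair_map (x : A) : B * C := (f x, g x).

Lemma pair_map_is_linear : linear pair_map.
Proof. by move=> a x y; rewrite /pair_map !linearP. Qed.

HB.instance Definition _ :=
  GRing.isLinear.Build K A (B * C)%type *:%R pair_map pair_map_is_linear.

End Pairing.

Section Kernel.
Variables (A B : lmodType K) (f : {linear A -> B}).

Definition kernel : pred A := fun x => f x == 0.

Lemma kernel_submod_closed : submod_closed kernel.
Proof.
split=> [|a x y]; rewrite !unfold_in /kernel ?linear0 // => /eqP fx /eqP fy.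
by rewrite linearP fx fy scaler0 addr0.
Qed.

HB.instance Definition _ :=
  GRing.isSubmodClosed.Build K A kernel kernel_submod_closed.

Record kernel_mod := KernelMod { kernel_val : A; _ : kernel_val \in kernel }.

HB.instance Definition _ := [isSub for kernel_val].
HB.instance Definition _ := [Choice of kernel_mod by <:].
HB.instance Definition _ := [SubChoice_isSubLmodule of kernel_mod by <:].

End Kernel.

Lemma mod_iso_inv (A B : lmodType K) :
  mod_iso A B ->
  exists (f : {linear A -> B}) (g : {linear B -> A}), cancel f g /\ cancel g f.
Proof.
case=> f [g fK gK].
have g_lin : linear g by apply: (can2_linear fK gK).
pose h : {linear B -> A} :=
  HB.pack_for {linear B -> A} g (GRing.isLinear.Build K B A *:%R g g_lin).
by exists f, h.
Qed.

Lemma mod_iso_can (A B : lmodType K) (f : {linear A -> B})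
  (g : {linear B -> A}) : cancel f g -> cancel g f -> mod_iso A B.
Proof. by move=> fK gK; exists f, g. Qed.

Lemma mod_iso_refl (A : lmodType K) : mod_iso A A.
Proof. by exists idfun, idfun. Qed.

Lemma mod_iso_trans (A B C : lmodType K) :
  mod_iso A B -> mod_iso B C -> mod_iso A C.
Proof. by move=> [f bf] [g bg]; exists (g \o f); apply: bij_comp. Qed.

Lemma mod_iso_swap_prod (A B A' B' : lmodType K) :
  mod_iso A A' -> mod_iso B B' -> mod_iso (A * B)%type (B' * A')%type.
Proof.
move=> /mod_iso_inv[f [f' [fK f'K]]] /mod_iso_inv[g [g' [gK g'K]]].
apply: (@mod_iso_can _ _ (pair_map (g \o snd) (f \o fst))
                         (pair_map (f' \o snd) (g' \o fst))).
- by case=> x y; rewrite /= /pair_map /= fK gK.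
- by case=> x y; rewrite /= /pair_map /= f'K g'K.
Qed.

(** Unlike in the definition of projectivity, [g] need not be onto: the
projection to [P] of the pullback of [f] and [g] is onto, and a section of it
followed by the projection to [X] is the lift. *)
Lemma projective_lift (P X Y : lmodType K) (g : {linear X -> Y})
    (f : {linear P -> Y}) :
  projective P -> (forall p, exists x, g x = f p) ->
  exists h : {linear P -> X}, forall p, g (h p) = f p.
Proof.
move=> projP lift_f.
(* The pullback of f and g is the kernel of g (-) f. *)
pose u : {linear (X * P)%type -> Y} := map_oplus g (\- f).
pose pr : {linear kernel_mod u -> P} := snd \o val.
have pr_surj : surjective pr.
  move=> p; have [x gx] := lift_f p.
  have Kxp : (x, p) \in kernel u.
    by rewrite unfold_in /kernel /u /= /map_oplus /= gx subrr.
  by exists (KernelMod Kxp).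
have [s sK] := projP _ _ pr idfun pr_surj.
exists (fst \o (val \o s)) => p /=.
have /eqP := valP (s p); rewrite /u /= /map_oplus /= => /eqP.
by rewrite subr_eq0 => /eqP->; congr (f _); apply: sK.
Qed.

Lemma projective_prod (P Q : lmodType K) :
  projective P -> projective Q -> projective (P * Q)%type.
Proof.
move=> projP projQ X Y g f g_surj.
have [h hE] := projP X Y g (f \o pair_map idfun \0) g_surj.
have [k kE] := projQ X Y g (f \o pair_map \0 idfun) g_surj.
exists (map_oplus h k) => -[p q].
rewrite /= /map_oplus /= linearD hE kE /= -linearD; congr (f _).
by congr (_, _); rewrite /= (addr0, add0r).
Qed.

(** The product of the elementary matrices sending (x, y) to (x - b y, y) and
(x, y) to (x, y + a x), followed by the exchange of the two summands. *)
Definition schanuel_map (A B : lmodType K) (a : {linear A -> B})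
    (b : {linear B -> A}) : {linear (A * B)%type -> (B * A)%type} :=
  pair_map (map_oplus a (idfun \- (a \o b))) (map_oplus idfun (\- b)).

(** The inverse of such a product is again of this form, with [a] and [b]
exchanged, so that one computation yields both cancellation laws. *)
Lemma schanuel_mapK (A B : lmodType K) (a : {linear A -> B})
    (b : {linear B -> A}) :
  cancel (schanuel_map a b) (schanuel_map b a).
Proof.
case=> x y; rewrite /schanuel_map /= /pair_map /= /map_oplus /=.
rewrite linearD !linearB /=; congr (_, _).
  rewrite -opprD [b (a x) + _]addrCA -[x - b y - _]addrA -opprD.
  by rewrite [LHS]addrCA subrr addr0.
by rewrite -opprD addrCA -addrA subrr addr0.
Qed.

(** Lifting phi \o a through b and psi \o b through a gives maps between [A] and
[B], and the associated [schanuel_map]s preserve the augmentations because the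
correction term y - u (v y) is killed by b, and x - v (u x) by a. *)
Lemma schanuel (A B M N : lmodType K) (a : {linear A -> M})
    (b : {linear B -> N}) (phi : {linear M -> N}) (psi : {linear N -> M}) :
  projective A -> projective B -> cancel phi psi -> cancel psi phi ->
  (forall x, exists y, b y = phi (a x)) ->
  (forall y, exists x, a x = psi (b y)) ->
  exists (f : {linear (A * B)%type -> (B * A)%type})
         (g : {linear (B * A)%type -> (A * B)%type}),
    [/\ cancel f g, cancel g f,
        forall z, b (f z).1 = phi (a z.1) &
        forall z, a (g z).1 = psi (b z.1)].
Proof.
move=> projA projB phiK psiK sub_ab sub_ba.
have [u uE] := projective_lift (f := phi \o a) projA sub_ab.
have [v vE] := projective_lift (f := psi \o b) projB sub_ba.
exists (schanuel_map u v), (schanuel_map v u).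
split; try exact: schanuel_mapK; case=> x y;
  rewrite /= /map_oplus /= linearD linearB /= !(uE, vE) /= !(uE, vE) /=.
- by rewrite psiK subrr addr0.
- by rewrite phiK subrr addr0.
Qed.

End LinearMaps.

(** * Homotopy equivalences relative to degree 0 *)

Section RelativeEquivalence.
Variable K : pzRingType.

(** [u] is homotopic to the identity by a homotopy vanishing in degree 0. As a
plain family of functions, [u] can be any composite of linear maps. *)
Definition rel_deformation (C : nat -> lmodType K)
    (dC : forall i, {linear C i.+1 -> C i}) (u : forall i, C i -> C i) : Prop :=
  exists h : forall i, {linear C i -> C i.+1},
    [/\ forall x, u 0%N x = x, forall x, h 0%N x = 0 &
        forall i x, u i.+1 x - x = dC i.+1 (h i.+1 x) + h i (dC i x)].

(** A homotopy equivalence that extends given maps [phi] and [psi] in degree 0.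
These are plain functions, so that composites of them can be compared by
conversion. *)
Definition rel_equiv (C D : nat -> lmodType K)
    (dC : forall i, {linear C i.+1 -> C i})
    (dD : forall i, {linear D i.+1 -> D i})
    (phi : C 0%N -> D 0%N) (psi : D 0%N -> C 0%N) : Prop :=
  exists (f : forall i, {linear C i -> D i})
         (g : forall i, {linear D i -> C i}),
    [/\ (forall x, f 0%N x = phi x) /\ (forall y, g 0%N y = psi y),
        forall i x, f i (dC i x) = dD i (f i.+1 x),
        forall i y, g i (dD i y) = dC i (g i.+1 y),
        rel_deformation dC (fun i x => g i (f i x)) &
        rel_deformation dD (fun i y => f i (g i y))].

Section Operations.
Variables (C D : nat -> lmodType K).
Variables (dC : forall i, {linear C i.+1 -> C i}).
Variables (dD : forall i, {linear D i.+1 -> D i}).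

Lemma rel_equiv_sym phi psi :
  rel_equiv dC dD phi psi -> rel_equiv dD dC psi phi.
Proof. by case=> f [g [[f0 g0] fd gd hC hD]]; exists g, f. Qed.

(** From g u f - 1 = g (u - 1) f + (g f - 1), if k contracts u - 1 and h
contracts g f - 1 then g k f + h contracts the left-hand side. *)
Lemma rel_deformation_comp (f : forall i, {linear C i -> D i})
    (g : forall i, {linear D i -> C i}) (u : forall i, D i -> D i) :
  (forall i x, f i (dC i x) = dD i (f i.+1 x)) ->
  (forall i y, g i (dD i y) = dC i (g i.+1 y)) ->
  rel_deformation dC (fun i x => g i (f i x)) -> rel_deformation dD u ->
  rel_deformation dC (fun i x => g i (u i (f i x))).
Proof.
move=> fd gd [h [gf0 h0 hE]] [k [u0 k0 kE]].
exists (fun i => (g i.+1 \o (k i \o f i)) \+ h i); split=> [x|x|i x] /=.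
- by rewrite u0 gf0.
- by rewrite k0 linear0 h0 add0r.
- rewrite -[LHS](subrKA (g i.+1 (f i.+1 x))) -linearB kE hE fd.
  by rewrite !linearD gd addrACA.
Qed.

(** One more degree can be added below because the homotopies of the given
equivalence vanish in what becomes degree 1: there the composites are equal to
the identity, and no homotopy from the new degree 0 is needed. *)
Lemma rel_equiv_cons (phi : {linear C 0%N -> D 0%N})
    (psi : {linear D 0%N -> C 0%N})
    (phi1 : C 1%N -> D 1%N) (psi1 : D 1%N -> C 1%N) :
  cancel phi psi -> cancel psi phi ->
  (forall x, phi (dC 0%N x) = dD 0%N (phi1 x)) ->
  (forall y, psi (dD 0%N y) = dC 0%N (psi1 y)) ->
  rel_equiv (C := fun i => C i.+1) (D := fun i => D i.+1)
    (fun i => dC i.+1) (fun i => dD i.+1) phi1 psi1 ->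
  rel_equiv dC dD phi psi.
Proof.
move=> phiK psiK phid psid [f [g [[f0 g0] fd gd]]].
case=> [h [gf0 h0 hE]] [k [fg0 k0 kE]].
exists (fun i => match i return {linear C i -> D i} with
                 | 0 => phi | j.+1 => f j end).
exists (fun i => match i return {linear D i -> C i} with
                 | 0 => psi | j.+1 => g j end).
split=> //.
- by case=> [|i] x; rewrite ?phid ?f0 ?fd.
- by case=> [|i] x; rewrite ?psid ?g0 ?gd.
- exists (fun i => match i return {linear C i -> C i.+1} with
                   | 0 => \0 | j.+1 => h j end).
  split=> // -[|i] x; last exact: hE.
  by rewrite gf0 h0 linear0 addr0 subrr.
- exists (fun i => match i return {linear D i -> D i.+1} with
                   | 0 => \0 | j.+1 => k j end).
  split=> // -[|i] x; last exact: kE.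
  by rewrite fg0 k0 linear0 addr0 subrr.
Qed.

End Operations.

Lemma rel_equiv_trans (C D E : nat -> lmodType K)
    (dC : forall i, {linear C i.+1 -> C i})
    (dD : forall i, {linear D i.+1 -> D i})
    (dE : forall i, {linear E i.+1 -> E i}) phi psi phi' psi' :
  rel_equiv dC dD phi psi -> rel_equiv dD dE phi' psi' ->
  rel_equiv dC dE (phi' \o phi) (psi \o psi').
Proof.
case=> f [g [[f0 g0] fd gd hC hD]] [f' [g' [[f'0 g'0] f'd g'd hD' hE]]].
exists (fun i => f' i \o f i), (fun i => g i \o g' i); split.
- by split=> x /=; rewrite ?f0 ?f'0 ?g'0 ?g0.
- by move=> i x /=; rewrite fd f'd.
- by move=> i x /=; rewrite g'd gd.
- exact: rel_deformation_comp hC hD'.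
- exact: rel_deformation_comp hE hD.
Qed.

End RelativeEquivalence.

(** * Stabilized sequences and their expansion *)

Section Stabilized.
Variable K : pzRingType.
Implicit Types (P : nat -> lmodType K) (S B : lmodType K).

(** The sequence P with the contractible complex B = B added in indices 1 and 2,
which are the chain degrees 0 and 1 as index 0 holds the augmentation module. *)
Definition expand P B (i : nat) : lmodType K :=
  match i with
  | 1 => (P 1%N * B)%type
  | 2 => (P 2%N * B)%type
  | _ => P i
  end.

Definition expand_diff P (d : forall i, {linear P i.+1 -> P i}) B i :
    {linear expand P B i.+1 -> expand P B i} :=
  match i with
  | 0 => d 0%N \o fst
  | 1 => pair_map (d 1%N \o fst) snd
  | 2 => pair_map (d 2) \0
  | j.+3 => d j.+3
  end.

Fixpoint stab_map P P' S n (u : forall i, {linear P i -> P' i}) i :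
    {linear stab_obj P S n i -> stab_obj P' S n i} :=
  match n, i with
  | 0, 0 => pair_map (u 0%N \o fst) snd
  | 0, _.+1 => \0
  | _.+1, 0 => u 0%N
  | m.+1, j.+1 => stab_map S m (fun k => u k.+1) j
  end.

Lemma zero_modE (x y : zero_mod K) : x = y.
Proof. by rewrite [x]thinmx0 [y]thinmx0. Qed.

Lemma stab_map_comm P P' S n (d : forall i, {linear P i.+1 -> P i})
    (d' : forall i, {linear P' i.+1 -> P' i})
    (u : forall i, {linear P i -> P' i}) :
  (forall i x, u i (d i x) = d' i (u i.+1 x)) ->
  forall i x, stab_map S n u i (stab_diff d S n i x) =
              stab_diff d' S n i (stab_map S n u i.+1 x).
Proof.
elim: n P P' d d' u => [|n IHn] P P' d d' u ud i x /=; first by rewrite linear0.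
case: i x => [|i] x; last exact: (IHn _ _ (fun k => d k.+1)).
by case: n {IHn} x => [|n] x /=; rewrite /map_oplus /= ?linearD ?linear0 ud.
Qed.

(** The stabilizing summand sits in degree 0 exactly when n = 0; [stab_in] and
[stab_diff0_in] let both cases be handled together. *)
Definition stab_in P S n : {linear P 0%N -> stab_obj P S n 0%N} :=
  match n with
  | 0 => pair_map idfun \0
  | _.+1 => idfun
  end.

Lemma stab_diff0_in P S n (d : {linear P 1%N -> P 0%N}) (x : P 1%N) :
  stab_diff0 S d n (stab_in (fun k => P k.+1) S n x) = d x.
Proof. by case: n => [|n] //=; rewrite /map_oplus /= addr0. Qed.

Definition expand_inj P B i : {linear P i -> expand P B i} :=
  match i with
  | 0 => idfun
  | 1 => pair_map idfun \0
  | 2 => pair_map idfun \0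
  | j.+3 => idfun
  end.

Definition expand_proj P B i : {linear expand P B i -> P i} :=
  match i with
  | 0 => idfun
  | 1 => fst
  | 2 => fst
  | j.+3 => idfun
  end.

Lemma stab_mapK P P' S n (u : forall i, {linear P i -> P' i})
    (v : forall i, {linear P' i -> P i}) :
  (forall i, cancel (u i) (v i)) ->
  forall i, cancel (stab_map S n u i) (stab_map S n v i).
Proof.
elim: n P P' u v => [|n IHn] P P' u v uK [|i] x /=.
- by case: x => x s; rewrite /pair_map /= uK.
- exact: zero_modE.
- exact: uK.
- exact: (IHn _ _ (fun k => u k.+1)).
Qed.

(** The inclusion and the projection are inverse to each other up to the
contraction of B = B, which is minus the identity of B from index 1 to 2. *)
Lemma expand_equiv P (d : forall i, {linear P i.+1 -> P i}) B S n :
  rel_equiv (stab_diff d S n.+2) (stab_diff (expand_diff d B) S n.+2) id id.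
Proof.
exists (stab_map S n.+2 (expand_inj P B)), (stab_map S n.+2 (expand_proj P B)).
split=> //.
- by apply: stab_map_comm => -[|[|[|i]]] x.
- by apply: stab_map_comm => -[|[|[|i]]] x.
- exists (fun=> \0); split=> // i x.
  rewrite stab_mapK ?linear0 ?addr0 ?subrr //.
  by case=> [|[|[|j]]] y.
exists (fun i => match i return
    {linear stab_obj (expand P B) S n.+2 i ->
            stab_obj (expand P B) S n.+2 i.+1} with
  | 0 => \0
  | 1 => \- (stab_in (fun k => expand P B k.+2) S n \o pair_map \0 snd)
  | _ => \0
  end).
split=> // -[|[|i]] x.
- rewrite addr0 -[stab_map _ _ _ _ _]/(x.1, 0).
  rewrite /= linearN stab_diff0_in.
  case: x => p b; rewrite -[RHS]/(- (d 1%N 0, b)) linear0; congr (_, _).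
    by rewrite subrr oppr0.
  by rewrite sub0r.
(* The B-component of an element of index 2, which the projection kills, is *)
(* also the B-component of its boundary, where the homotopy picks it up.    *)
- transitivity (- stab_in (fun k => expand P B k.+2) S n
      (0, (stab_diff (expand_diff d B) S n.+2 1 x).2)); last first.
    by rewrite -[LHS]add0r /= linear0.
  case: n x => [|n] x /=.
    case: x => [[p b] s]; rewrite /pair_map /map_oplus /= addr0.
    congr ((_, _), _); rewrite /= ?sub0r ?subrr ?oppr0 //.
  case: x => p b; rewrite /pair_map /=.
  congr (_, _); rewrite /= ?sub0r ?subrr ?oppr0 //.
- rewrite linear0 addr0; apply/eqP; rewrite subr_eq0; apply/eqP.
  by case: n x => [|n] x /=; first exact: zero_modE; apply: stab_mapK.
Qed.

(** The image of the expanded differential in index 1 depends only on the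
original augmentation, which is what Schanuel's isomorphism preserves. *)
Lemma expand_image P (d : forall i, {linear P i.+1 -> P i}) B (z : P 1%N * B) :
  exact_at (d 1%N) (d 0%N) ->
  d 0%N z.1 = 0 <-> exists x, expand_diff d B 1 x = z.
Proof.
case: z => p b exd; split=> [/exd[x xE] | [x [xE _]]].
  by exists (x, b); rewrite -[LHS]/(d 1%N x, b) xE.
by apply/exd; exists x.1.
Qed.

Lemma expand_exact P (d : forall i, {linear P i.+1 -> P i}) B n :
  (forall i, (i < n.+1)%N -> exact_at (d i.+1) (d i)) ->
  forall i, (i < n)%N -> exact_at (expand_diff d B i.+2) (expand_diff d B i.+1).
Proof.
move=> exd [|[|i]] lt_in; last exact: exd.
  case=> p b; split=> [[dp b0] | [x <-]].
    have [x xE] := (exd 1%N lt_in p).1 dp.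
    by exists x; rewrite -xE -[b]/((p, b).2) /= b0.
  by congr (_, _); apply/(exd 1%N lt_in); exists x.
move=> p; split=> [[/(exd 2 lt_in)] // | [x xE]].
by congr (_, _); apply/(exd 2 lt_in); exists x.
Qed.

Lemma expand_projective P B n :
  (forall i, (i <= n.+1)%N -> projective (P i.+1)) -> projective B ->
  forall i, (i <= n)%N -> projective (expand P B i.+2).
Proof.
move=> projP projB [|i] le_in; last exact: projP.
exact: projective_prod (projP 1%N isT) projB.
Qed.

(** * Peeling off the lowest degree *)

(** The theorem in the form in which it can be proved by induction on the
length: [P 0] and [Q 0] are the augmentation modules, identified by [phi] and
[psi], and the lowest modules [P 1] and [Q 1] are copies of T_0 and S_0. In
the step, the induction hypothesis is applied to the expanded sequences without
their augmentation modules, Schanuel's isomorphism serving as the new [phi]. *)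
Lemma stab_equiv n (P Q : nat -> lmodType K)
    (d : forall i, {linear P i.+1 -> P i})
    (d' : forall i, {linear Q i.+1 -> Q i}) (T S : nat -> lmodType K)
    (phi : {linear P 0%N -> Q 0%N}) (psi : {linear Q 0%N -> P 0%N}) :
  cancel phi psi -> cancel psi phi ->
  (forall x, exists y, d' 0%N y = phi (d 0%N x)) ->
  (forall y, exists x, d 0%N x = psi (d' 0%N y)) ->
  (forall i, (i < n)%N -> exact_at (d i.+1) (d i)) ->
  (forall i, (i < n)%N -> exact_at (d' i.+1) (d' i)) ->
  (forall i, (i <= n)%N -> projective (P i.+1)) ->
  (forall i, (i <= n)%N -> projective (Q i.+1)) ->
  mod_iso (T 0%N) (P 1%N) -> mod_iso (S 0%N) (Q 1%N) ->
  (forall i, (i < n)%N -> mod_iso (T i.+1) (S i * P i.+2)%type) ->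
  (forall i, (i < n)%N -> mod_iso (S i.+1) (T i * Q i.+2)%type) ->
  rel_equiv (stab_diff d (S n) n.+1) (stab_diff d' (T n) n.+1) phi psi.
Proof.
elim: n P Q d d' T S phi psi => [|n IHn] P Q d d' T S phi psi.
all: move=> phiK psiK sub_dd' sub_d'd exP exQ projP projQ T0 S0 T_rec S_rec.
all: have [F [G [FK GK dF dG]]] :=
  schanuel (projP 0%N isT) (projQ 0%N isT) phiK psiK sub_dd' sub_d'd.
- have [tau [tau' [tauK tau'K]]] := mod_iso_inv T0.
  have [sig [sig' [sigK sig'K]]] := mod_iso_inv S0.
  (* Schanuel's isomorphism, transported along S_0 ~ Q_1 and T_0 ~ P_1. *)
  pose f1 : {linear (P 1%N * S 0%N)%type -> (Q 1%N * T 0%N)%type} :=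
    pair_map (fst \o (F \o pair_map fst (sig \o snd)))
             (tau' \o (snd \o (F \o pair_map fst (sig \o snd)))).
  pose g1 : {linear (Q 1%N * T 0%N)%type -> (P 1%N * S 0%N)%type} :=
    pair_map (fst \o (G \o pair_map fst (tau \o snd)))
             (sig' \o (snd \o (G \o pair_map fst (tau \o snd)))).
  have f1E p s : f1 (p, s) = ((F (p, sig s)).1, tau' (F (p, sig s)).2) by [].
  have g1E q t : g1 (q, t) = ((G (q, tau t)).1, sig' (G (q, tau t)).2) by [].
  have f1K : cancel f1 g1.
    by case=> p s; rewrite f1E g1E tau'K -surjective_pairing FK /= sigK.
  have g1K : cancel g1 f1.
    by case=> q t; rewrite g1E f1E sig'K -surjective_pairing GK /= tauK.
  apply: (rel_equiv_cons (phi1 := f1) (psi1 := g1)) => //.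
  + by case=> p s; rewrite f1E /= /map_oplus /= !addr0 dF.
  + by case=> q t; rewrite g1E /= /map_oplus /= !addr0 dG.
  exists (fun i => match i return
      {linear stab_obj P (S 0%N) 1 i.+1 -> stab_obj Q (T 0%N) 1 i.+1} with
    | 0 => f1 | _ => \0 end).
  exists (fun i => match i return
      {linear stab_obj Q (T 0%N) 1 i.+1 -> stab_obj P (S 0%N) 1 i.+1} with
    | 0 => g1 | _ => \0 end).
  split=> //; try by move=> i x /=; rewrite linear0; case: i x.
  + exists (fun=> \0); split=> // i x; exact: zero_modE.
  + exists (fun=> \0); split=> // i x; exact: zero_modE.
- suff eq_exp : rel_equiv (stab_diff (expand_diff d (Q 1%N)) (S n.+1) n.+2)
                          (stab_diff (expand_diff d' (P 1%N)) (T n.+1) n.+2)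
                          phi psi.
    exact: (rel_equiv_trans
              (rel_equiv_trans (expand_equiv d (Q 1%N) (S n.+1) n) eq_exp)
              (rel_equiv_sym (expand_equiv d' (P 1%N) (T n.+1) n))).
  apply: (rel_equiv_cons (phi1 := F) (psi1 := G)) => // [z|z|].
  + exact/esym/dF.
  + exact/esym/dG.
  apply: (IHn (fun k => expand P (Q 1%N) k.+1) (fun k => expand Q (P 1%N) k.+1)
    (fun k => expand_diff d (Q 1%N) k.+1) (fun k => expand_diff d' (P 1%N) k.+1)
    (fun k => T k.+1) (fun k => S k.+1) F G) => //.
  + move=> x; apply: (expand_image (d := d') (F _) (exQ 0%N isT)).1.
    rewrite dF (expand_image (d := d) _ (exP 0%N isT)).2 ?linear0 //.
    by exists x.
  + move=> y; apply: (expand_image (d := d) (G _) (exP 0%N isT)).1.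
    rewrite dG (expand_image (d := d') _ (exQ 0%N isT)).2 ?linear0 //.
    by exists y.
  + exact: expand_exact exP.
  + exact: expand_exact exQ.
  + exact: expand_projective projP (projQ 0%N isT).
  + exact: expand_projective projQ (projP 0%N isT).
  + apply: mod_iso_trans (T_rec 0%N isT) _.
    exact: mod_iso_swap_prod S0 (mod_iso_refl _).
  + apply: mod_iso_trans (S_rec 0%N isT) _.
    exact: mod_iso_swap_prod T0 (mod_iso_refl _).
  + by move=> i; apply: (T_rec i.+1).
  + by move=> i; apply: (S_rec i.+1).
Qed.

Definition augment P (M : lmodType K) (i : nat) : lmodType K :=
  if i is j.+1 then P j else M.

Definition augment_diff P (d : forall i, {linear P i.+1 -> P i})
    (M : lmodType K) (eps : {linear P 0%N -> M}) i :
    {linear augment P M i.+1 -> augment P M i} :=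
  match i with
  | 0 => eps
  | j.+1 => d j
  end.

End Stabilized.

(** * The theorem *)

Theorem theorem1p1 (R : pzRingType) (M : lmodType R^c) (n : nat)
    (P Q : nat -> lmodType R^c)
    (d : forall i, {linear P i.+1 -> P i})
    (d' : forall i, {linear Q i.+1 -> Q i})
    (eps : {linear P 0%N -> M}) (eps' : {linear Q 0%N -> M})
    (ex_P : exact_seq n d eps) (ex_Q : exact_seq n d' eps')
    (proj_P : forall i, (i <= n)%N -> projective (P i))
    (proj_Q : forall i, (i <= n)%N -> projective (Q i))
    (T S : nat -> lmodType R^c)
    (T0 : mod_iso (T 0%N) (P 0%N)) (S0 : mod_iso (S 0%N) (Q 0%N))
    (T_rec : forall i, (i < n)%N -> mod_iso (T i.+1) (S i * P i.+1)%type)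
    (S_rec : forall i, (i < n)%N -> mod_iso (S i.+1) (T i * Q i.+1)%type) :
  chain_homotopy_equivalent (stab_complex ex_P (S n)) (stab_complex ex_Q (T n)).
Proof.
have ex_aug (X : nat -> lmodType R^c) (dX : forall i, {linear X i.+1 -> X i})
    (e : {linear X 0%N -> M}) : exact_seq n dX e ->
    forall i, (i < n)%N ->
      exact_at (augment_diff dX e i.+1) (augment_diff dX e i).
  by case=> _ ex0 exS [|i]; [apply: ex0 | apply: exS].
have [eps_surj _ _] := ex_P; have [eps'_surj _ _] := ex_Q.
(* Onto the same module, the augmentations have corresponding images. *)
have := @stab_equiv _ n (augment P M) (augment Q M) (augment_diff d eps)
  (augment_diff d' eps') T S idfun idfun (fun _ => erefl) (fun _ => erefl)
  (fun x => eps'_surj _) (fun y => eps_surj _) (ex_aug _ _ _ ex_P)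
  (ex_aug _ _ _ ex_Q) proj_P proj_Q T0 S0 T_rec S_rec.
case=> f [g [[f0 g0] fd gd [h [_ h0 hE]] [k [_ k0 kE]]]].
pose F : chain_map (stab_complex ex_P (S n)) (stab_complex ex_Q (T n)) :=
  @ChainMap _ (stab_complex ex_P (S n)) (stab_complex ex_Q (T n))
    (fun i => f i.+1) (fun i => fd i.+1).
pose G : chain_map (stab_complex ex_Q (T n)) (stab_complex ex_P (S n)) :=
  @ChainMap _ (stab_complex ex_Q (T n)) (stab_complex ex_P (S n))
    (fun i => g i.+1) (fun i => gd i.+1).
exists F, G; split.
- exists (fun i => h i.+1); split=> [x|i x]; last exact: (hE i.+1).
  by rewrite /= hE h0 addr0.
- exists (fun i => k i.+1); split=> [x|i x]; last exact: (kE i.+1).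
  by rewrite /= kE k0 addr0.
Qed.
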